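(* Let $h_1$ and $h_2$ be two distinct extremal potentials on a recurrent rooted network $(G,c,o)$, and let $\{Y_n\}_{n\ge0}$ and $\{Z_n\}_{n\ge0}$ be the $h_1$-process and the $h_2$-process, respectively, defined on a common probability space (no independence is assumed). Then their trajectories intersect finitely often almost surely, that is, the set $\{(m,n):Y_m=Z_n\}$ is almost surely finite.
   Context: A network $(G,c)$ is an infinite, connected, locally finite graph $G=(V,E)$ with positive edge weights (conductances) $c_{xy}=c_{yx}$, $xy\in E$; put $c_x=\sum_{z\sim x}c_{xz}$. The network random walk is the Markov chain on $V$ with transition probabilities $p(x,y)=c_{xy}/c_x$ for $x\sim y$. The network is recurrent if this walk is recurrent. A rooted network $(G,c,o)$ is a network with a distinguished vertex $o\in V$. The Laplacian of $f:V\to\mathbb{R}$ is $\Delta f(v)=\sum_{x\sim v}c_{vx}(f(x)-f(v))$. A potential on $(G,c,o)$ is a function $h:V\to[0,\infty)$ with $h(o)=0$, $\Delta h(o)=1$ and $\Delta h(v)=0$ for every $v\ne o$. A potential is extremal if it cannot be represented as a non-trivial convex combination of potentials on $(G,c,o)$. For a potential $h$, the $h$-process is the Markov chain on $S_h=\{v:h(v)>0\}$ with transition probabilities $p^h(x,y)=p(x,y)h(y)/h(x)$, started from the initial distribution $\mu_h(v)=c_{ov}h(v)$, $v\sim o$ (a probability measure since $\Delta h(o)=1$). *)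

(* Defs.v *)
From HB Require Import structures.
From mathcomp Require Import all_boot all_order all_algebra.
From mathcomp Require Import all_classical all_reals all_analysis.

Set Implicit Arguments.
Unset Strict Implicit.
Unset Printing Implicit Defensive.

Import Order.TTheory GRing.Theory Num.Theory.

Local Open Scope classical_set_scope.
Local Open Scope ring_scope.

(* The vertex set is the whole type [V] and the graph is simple.  The values
   of [cond] on non-adjacent pairs are irrelevant: they are never used. *)
Record network (R : realType) (V : choiceType) := Network {
  adj : rel V;
  cond : V -> V -> R;
  network_infinite : infinite_set [set: V];
  adj_irr : irreflexive adj;
  adj_sym : symmetric adj;
  adj_connected : forall x y, exists s, path adj x s /\ last x s = y;
  adj_locally_finite : forall x, finite_set [set y | adj x y];
  cond_gt0 : forall x y, adj x y -> 0 < cond x y;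
  cond_sym : forall x y, adj x y -> cond x y = cond y x
}.

Section Potentials.
Variables (R : realType) (V : choiceType) (N : network R V).

Definition neighbors (x : V) : set V := [set y | adj N x y].

Definition total_cond (x : V) : R := \sum_(z \in neighbors x) cond N x z.

Definition trans_prob (x y : V) : R :=
  if adj N x y then cond N x y / total_cond x else 0.

Definition laplacian (f : V -> R) (v : V) : R :=
  \sum_(x \in neighbors v) cond N v x * (f x - f v).

Definition potential (o : V) (h : V -> R) : Prop :=
  [/\ forall v, 0 <= h v,
      h o = 0,
      laplacian h o = 1 &
      forall v, v <> o -> laplacian h v = 0].

Definition extremal_potential (o : V) (h : V -> R) : Prop :=
  potential o h /\
  ~ exists (h' h'' : V -> R) (t : R),
      [/\ potential o h', potential o h'', h' <> h'', 0 < t < 1 &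
          forall v, h v = t * h' v + (1 - t) * h'' v].

End Potentials.

(* [V] carries the discrete sigma-algebra.  The last clause is the Markov
   property P(X_{n+1} = x_{n+1} | X_0 = x_0, ..., X_n = x_n) = p(x_n, x_{n+1})
   multiplied out, which for a null conditioning event reads 0 = 0. *)
Definition markov_chain (R : realType) (V : choiceType) (d : measure_display)
    (T : measurableType d) (P : probability T R)
    (S : set V) (mu : V -> R) (p : V -> V -> R) (X : nat -> T -> V) : Prop :=
  [/\ forall n (A : set V), measurable (X n @^-1` A),
      forall n w, S (X n w),
      forall v, S v -> P [set w | X 0%N w = v] = (mu v)%:E &
      forall n (x : nat -> V), (forall i, S (x i)) ->
        P [set w | forall i, (i <= n.+1)%N -> X i w = x i] =
        (P [set w | forall i, (i <= n)%N -> X i w = x i]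
           * (p (x n) (x n.+1))%:E)%E].

Section Walks.
Variables (R : realType) (V : choiceType) (N : network R V).
Variables (d : measure_display) (T : measurableType d) (P : probability T R).

Definition random_walk (x : V) (X : nat -> T -> V) : Prop :=
  markov_chain P [set: V] (fun v => (v == x)%:R) (trans_prob N) X.

Definition h_process (o : V) (h : V -> R) (Y : nat -> T -> V) : Prop :=
  markov_chain P [set v | 0 < h v]
    (fun v => if adj N o v then cond N o v * h v else 0)
    (fun x y => trans_prob N x y * h y / h x) Y.

End Walks.

(* The law of the walk started at [x] is determined by [random_walk], so the
   return probability does not depend on the realization of the walk. *)
Definition recurrent (R : realType) (V : choiceType) (N : network R V) : Prop :=
  forall x : V,
    exists (d : measure_display) (T : measurableType d) (P : probability T R)
           (X : nat -> T -> V),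
      random_walk N P x X /\
      P [set w | exists2 n, (0 < n)%N & X n w = x] = 1%E.

(* Main.v *)
Require Import Defs.
From HB Require Import structures.
From mathcomp Require Import all_boot all_order all_algebra finmap.
From mathcomp Require Import all_classical all_reals all_analysis.
From mathcomp Require Import ring.

Set Implicit Arguments.
Unset Strict Implicit.
Unset Printing Implicit Defensive.

Import Order.TTheory GRing.Theory Num.Theory.
Import numFieldNormedType.Exports.

Local Open Scope classical_set_scope.
Local Open Scope ring_scope.

(* Work with the walk killed at [o], for which potentials are the normalized
   nonnegative harmonic functions.  Let [h] be an extremal potential and
   [g >= 0] superharmonic with [g x < h x] for some [x].  The limit of the
   killed semigroup applied to [min h g] is a harmonic function
   [f <= min h g], so [f = c h] by extremality, and [c < 1].  Then
   [u := (min h g - f) / (1 - c)] is superharmonic, dominates [h] where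
   [h <= g], and its image under the killed semigroup tends to [0].  Since
   [u / h] is a supermartingale along the [h]-process, the latter eventually
   stays in [g < h].

   With [g] another potential, the [h1]-process ends up in [h2 < h1] and the
   [h2]-process in [h1 < h2]; with [g] a rational constant below [sup h], each
   vertex is visited finitely often, as [h] does not attain its supremum. *)

(** * Potentials and the walk killed at [o] *)

Section PotentialTheory.
Variables (R : realType) (V : choiceType) (N : network R V) (o : V).
Implicit Types (u f g h : V -> R) (x y v : V) (a b : R) (n k : nat).

Definition nbs x : seq V := fset_set (neighbors N x).

Lemma mem_nbs x y : (y \in nbs x) = adj N x y.
Proof.
rewrite /nbs in_fset_set; last exact: adj_locally_finite.
by apply/idP/idP; rewrite inE.
Qed.

Lemma nbs_uniq x : uniq (nbs x).
Proof. exact: fset_uniq. Qed.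

Lemma nbsE x (F : V -> R) :
  \sum_(y \in neighbors N x) F y = \sum_(y <- nbs x) F y.
Proof. by rewrite fsbig_finite//; exact: adj_locally_finite. Qed.

Lemma adj_ex x : exists y, adj N x y.
Proof.
have [y yx] : exists y, y != x.
  apply: contrapT => /forallNP nx; apply: (network_infinite N).
  apply: (sub_finite_set _ (finite_set1 x)) => y _ /=.
  by apply/eqP; apply: contrapT => /negP; exact: nx.
have [[|z s] /= [+ E]] := adj_connected N x y; first by rewrite E eqxx in yx.
by case/andP => xz _; exists z.
Qed.

(** Induction along a path: this is how connectedness enters the uniqueness and maximum arguments
    below. *)
Lemma adj_closed_full (A : set V) x :
  (forall y z, A y -> adj N y z -> A z) -> A x -> forall y, A y.
Proof.
move=> Acl Ax y; have [s [+ <-]] := adj_connected N x y.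
elim: s x Ax => [//|z s IH] x Ax /= /andP[xz]; apply: IH; exact: Acl xz.
Qed.

Lemma psumr_nbs_eq0 x (F : V -> R) :
  (forall y, adj N x y -> 0 <= F y) -> \sum_(y <- nbs x) F y = 0 ->
  forall y, adj N x y -> F y = 0.
Proof.
move=> F0 /eqP; rewrite big_seq psumr_eq0; last first.
  by move=> y; rewrite mem_nbs; exact: F0.
move=> /allP s0 y xy; have := s0 y; rewrite mem_nbs xy => /(_ isT) /=.
by move=> /eqP.
Qed.

Lemma total_cond_gt0 x : 0 < total_cond N x.
Proof.
have c0 y : adj N x y -> 0 <= cond N x y by move=> /cond_gt0/ltW.
rewrite /total_cond nbsE lt_neqAle eq_sym; apply/andP; split.
  apply/eqP => /(psumr_nbs_eq0 c0) E; have [y xy] := adj_ex x.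
  by have := cond_gt0 xy; rewrite E// ltxx.
by rewrite big_seq sumr_ge0// => y; rewrite mem_nbs; exact: c0.
Qed.

Lemma trans_prob_gt0 x y : adj N x y -> 0 < trans_prob N x y.
Proof.
by move=> xy; rewrite /trans_prob xy divr_gt0 ?cond_gt0 ?total_cond_gt0.
Qed.

Lemma trans_prob_ge0 x y : 0 <= trans_prob N x y.
Proof.
have [xy|nxy] := boolP (adj N x y); first exact/ltW/trans_prob_gt0.
by rewrite /trans_prob (negPf nxy).
Qed.

Lemma trans_prob_sum x : \sum_(y <- nbs x) trans_prob N x y = 1.
Proof.
rewrite (eq_big_seq (fun y => cond N x y / total_cond N x)); last first.
  by move=> y; rewrite mem_nbs /trans_prob => ->.
by rewrite -mulr_suml -nbsE mulfV// gt_eqF// total_cond_gt0.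
Qed.

(* One step of the walk killed at [o]. *)
Definition step u x : R :=
  if x == o then 0 else \sum_(y <- nbs x) trans_prob N x y * u y.

(** When [u o = 0] this is the Laplacian of [u] at [o]. It is also the mean of [u / h] under the
    initial law of the [h]-process, up to vertices where [h] vanishes. *)
Definition flow u : R := \sum_(y <- nbs o) cond N o y * u y.

Lemma ler_step u f x : (forall y, u y <= f y) -> step u x <= step f x.
Proof.
move=> uf; rewrite /step; case: ifP => // _.
by apply: ler_sum => y _; apply: ler_wpM2l; rewrite ?trans_prob_ge0.
Qed.

Lemma stepD a b u f x :
  step (fun y => a * u y + b * f y) x = a * step u x + b * step f x.
Proof.
rewrite /step; case: ifP => _; first by rewrite !mulr0 addr0.
by rewrite !mulr_sumr -big_split/=; apply: eq_bigr => y _; ring.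
Qed.

Lemma flowD a b u f :
  flow (fun y => a * u y + b * f y) = a * flow u + b * flow f.
Proof.
by rewrite /flow !mulr_sumr -big_split/=; apply: eq_bigr => y _; ring.
Qed.

Lemma ler_flow u f : (forall y, u y <= f y) -> flow u <= flow f.
Proof.
move=> uf; rewrite /flow big_seq [leRHS]big_seq; apply: ler_sum => y.
by rewrite mem_nbs => /cond_gt0 c0; rewrite ler_pM2l.
Qed.

(** Killing only loses mass; this makes constants admissible as levels [g] in the transience
    argument. *)
Lemma step_cst_le a x : 0 <= a -> step (fun=> a) x <= a.
Proof.
by move=> a0; rewrite /step; case: ifP => // _;
  rewrite -mulr_suml trans_prob_sum mul1r.
Qed.

Lemma laplacianE u x :
  laplacian N u x = \sum_(y <- nbs x) cond N x y * u y - total_cond N x * u x.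
Proof.
rewrite /laplacian /total_cond !nbsE mulr_suml -sumrB.
by apply: eq_bigr => y _; rewrite mulrBr.
Qed.

Lemma laplacian_step u x : x != o ->
  laplacian N u x = total_cond N x * (step u x - u x).
Proof.
move=> /negPf xo; rewrite laplacianE mulrBr /step xo mulr_sumr; congr (_ - _).
apply: eq_big_seq => y; rewrite mem_nbs /trans_prob => ->.
by have := total_cond_gt0 x => c0; field; rewrite gt_eqF.
Qed.

Lemma potentialP h : potential N o h <->
  [/\ forall v, 0 <= h v, h o = 0, flow h = 1 & forall v, step h v = h v].
Proof.
have E : h o = 0 -> laplacian N h o = flow h.
  by rewrite laplacianE => ->; rewrite mulr0 subr0.
split=> -[h0 ho ho1 hh]; split=> //; rewrite ?E// in ho1 *.
- move=> v; have [->|vo] := eqVneq v o; first by rewrite /step eqxx ho.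
  apply/eqP; rewrite -subr_eq0; have /eqP := hh v (elimN eqP vo).
  by rewrite laplacian_step// mulf_eq0 (gt_eqF (total_cond_gt0 v)).
- by move=> v /eqP vo; rewrite laplacian_step// hh subrr mulr0.
Qed.

Lemma step_eq0 u x : (forall y, 0 <= u y) -> x != o -> step u x = 0 ->
  forall y, adj N x y -> u y = 0.
Proof.
move=> u0 /negPf xo; rewrite /step xo => E y xy.
have pu0 z : adj N x z -> 0 <= trans_prob N x z * u z.
  by move=> _; rewrite mulr_ge0 ?trans_prob_ge0.
have /eqP := psumr_nbs_eq0 pu0 E xy.
by rewrite mulf_eq0 (gt_eqF (trans_prob_gt0 xy)) => /eqP.
Qed.

(** The zero set contains [o] and is closed under adjacency: the vanishing flow handles the edges
    out of [o], harmonicity all others. *)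
Lemma flow0_eq0 u : (forall y, 0 <= u y) -> u o = 0 ->
  (forall y, step u y = u y) -> flow u = 0 -> forall x, u x = 0.
Proof.
move=> u0 uo uh fu.
apply: (@adj_closed_full [set x | u x = 0] o) => //= y z uy yz.
have [yo|yo] := eqVneq y o; last by apply: (step_eq0 u0 yo _ yz); rewrite uh.
move: yz; rewrite yo => oz.
have := psumr_nbs_eq0 _ fu oz.
move=> /(_ (fun y oy => mulr_ge0 (ltW (cond_gt0 oy)) (u0 y)))/eqP.
by rewrite mulf_eq0 (gt_eqF (cond_gt0 oz)) => /eqP.
Qed.

(** The difference [f - h] is nonnegative, fixed by [step], and has flow [1 - 1 = 0]. *)
Lemma potential_le_eq h f : potential N o h -> potential N o f ->
  (forall x, h x <= f x) -> h = f.
Proof.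
move=> /potentialP[_ ho hf hh] /potentialP[_ fo ff fh] hlef.
have E : (fun x => 1 * f x + (-1) * h x) = (fun x => f x - h x).
  by apply/funext => x; ring.
apply/funext => x; apply/eqP; rewrite eq_sym -subr_eq0; apply/eqP.
apply: (@flow0_eq0 (fun x => f x - h x)).
- by move=> y; rewrite subr_ge0.
- by rewrite ho fo subrr.
- by move=> y; rewrite -E stepD hh fh; ring.
- by rewrite -E flowD hf ff; ring.
Qed.

(** At a maximum the averaging property forces the same value on all neighbours, and connectedness
    carries it to [o], where [h] vanishes. *)
Lemma potential_not_max h x : potential N o h -> 0 < h x ->
  exists y, h x < h y.
Proof.
move=> /potentialP[h0 ho _ hh] hx; apply: contrapT => /forallNP hmax.
have le y : h y <= h x by rewrite leNgt; apply/negP; exact: hmax.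
have : h o = h x.
  apply: (@adj_closed_full [set y | h y = h x] x) => //= y z hy yz.
  have yo : y != o.
    by apply: contra_ltN hx => /eqP yo; rewrite -hy yo ho.
  have E : (fun z => h x - h z) = (fun z => 1 * (fun=> h x) z + (-1) * h z).
    by apply/funext => t; ring.
  have /eqP : (fun z => h x - h z) z = 0.
    apply: (@step_eq0 (fun z => h x - h z) y) => //.
      by move=> t; rewrite subr_ge0.
    rewrite E stepD hh hy /step (negPf yo) -mulr_suml trans_prob_sum; ring.
  by rewrite subr_eq0 eq_sym => /eqP.
by rewrite ho => hx0; rewrite -hx0 ltxx in hx.
Qed.

(** For [flow f] strictly between 0 and 1, [h] is a convex combination of the normalized [f] and the
    normalized [h - f], so extremality identifies them. The values 0 and 1 fall to [flow0_eq0] and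
    [potential_le_eq]. *)
Lemma extremal_minorant h f : extremal_potential N o h ->
  (forall x, 0 <= f x <= h x) -> (forall x, step f x = f x) ->
  forall x, f x = flow f * h x.
Proof.
move=> [ph ext] fh fharm; have /potentialP[h0 ho hf hh] := ph.
have fo : f o = 0 by apply/eqP; have := fh o; rewrite ho eq_le andbC.
have f0 x : 0 <= f x by case/andP: (fh x).
have fleh x : f x <= h x by case/andP: (fh x).
set c := flow f.
have c0 : 0 <= c.
  have -> : 0 = flow (fun=> 0) by rewrite /flow big1// => *; rewrite mulr0.
  exact: ler_flow.
have c1 : c <= 1 by rewrite -hf; exact: ler_flow.
have [c0'|cn0] := eqVneq c 0.
  by move=> x; rewrite c0' mul0r; apply: flow0_eq0 x.
have [c1'|cn1] := eqVneq c 1.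
  have pf : potential N o f by apply/potentialP.
  by move=> x; rewrite c1' mul1r (potential_le_eq pf ph).
have cgt0 : 0 < c by rewrite lt_neqAle eq_sym cn0.
have clt1 : 0 < 1 - c by rewrite subr_gt0 lt_neqAle cn1.
(* The zero term gives [f1] the two-term shape that [stepD] and [flowD] expect. *)
pose f1 x := c^-1 * f x + 0 * h x.
pose f2 x := (1 - c)^-1 * h x + (- (1 - c)^-1) * f x.
have cne : 1 - c != 0 by rewrite gt_eqF.
have p1 : potential N o f1.
  apply/potentialP; split.
  - by move=> x; rewrite /f1 mul0r addr0 mulr_ge0// invr_ge0.
  - by rewrite /f1 fo ho !mulr0 addr0.
  - by rewrite /f1 flowD -/c mul0r addr0 mulVf.
  - by move=> x; rewrite /f1 stepD fharm hh.
have p2 : potential N o f2.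
  apply/potentialP; split.
  - move=> x; have -> : f2 x = (1 - c)^-1 * (h x - f x) by rewrite /f2; ring.
    by rewrite mulr_ge0 ?invr_ge0 ?subr_ge0// -subr_ge0 ltW.
  - by rewrite /f2 fo ho !mulr0 addr0.
  - by rewrite /f2 flowD -/c hf; field.
  - by move=> x; rewrite /f2 stepD fharm hh.
(* Extremality only excludes distinct components; if they coincide, both equal their convex
   combination [h]. *)
have [f12|f12] := pselect (f1 = f2).
  move=> x; have /(congr1 (fun u => u x)) := f12; rewrite /f1 /f2 => E.
  have -> : f x = c * (c^-1 * f x + 0 * h x) by field.
  have : (c + (1 - c)) * (c^-1 * f x + 0 * h x) = h x.
    by rewrite mulrDl {2}E; field; apply/andP; split.
  by rewrite addrCA subrr addr0 mul1r => ->.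
exfalso; apply: ext; exists f1, f2, c; split=> //.
  by rewrite cgt0 -subr_gt0.
by move=> x; rewrite /f1 /f2; field; apply/andP; split.
Qed.

(** * Iterates of the killed walk and the barrier function *)

Lemma iter_step_le g n x : (forall y, step g y <= g y) ->
  iter n.+1 step g x <= iter n step g x.
Proof.
by move=> gs; elim: n x => [|n IH] x; [exact: gs|apply: ler_step; exact: IH].
Qed.

Lemma step_ge0 u x : (forall y, 0 <= u y) -> 0 <= step u x.
Proof.
move=> u0; rewrite /step; case: ifP => // _.
by apply: sumr_ge0 => y _; rewrite mulr_ge0 ?trans_prob_ge0.
Qed.

Lemma iter_step_ge0 g n x : (forall y, 0 <= g y) -> 0 <= iter n step g x.
Proof. by move=> g0; elim: n x => [//|n IH] x; apply: step_ge0. Qed.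

Lemma cvg_step (u_ : nat -> V -> R) u x :
  (forall y, (u_ n y @[n --> \oo] --> u y)%classic) ->
  (step (u_ n) x @[n --> \oo] --> step u x)%classic.
Proof.
move=> uu; rewrite /step; case: ifP => _; first exact: cvg_cst.
apply: cvg_big => [|y _]; last by apply: cvgM; [exact: cvg_cst|exact: uu].
exact: add_continuous.
Qed.

Lemma cvg_flow (u_ : nat -> V -> R) u :
  (forall y, (u_ n y @[n --> \oo] --> u y)%classic) ->
  (flow (u_ n) @[n --> \oo] --> flow u)%classic.
Proof.
move=> uu; apply: cvg_big => [|y _]; last first.
  by apply: cvgM; [exact: cvg_cst|exact: uu].
exact: add_continuous.
Qed.

(** The iterates decrease and stay nonnegative, so they converge pointwise; [step] is a finite sum
    and commutes with the limit, which is therefore a fixed point. *)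
Lemma superharmonic_minorant g :
  (forall x, 0 <= g x) -> (forall x, step g x <= g x) ->
  exists f, [/\ forall x, 0 <= f x <= g x, forall x, step f x = f x &
    forall x, (iter n step g x @[n --> \oo] --> f x)%classic].
Proof.
move=> g0 gs.
have dec x : {homo (fun n => iter n step g x) : n m / (n <= m)%N >-> m <= n}.
  by apply/nonincreasing_seqP => n; exact: iter_step_le.
have cv x : cvgn (fun n => iter n step g x).
  apply: nonincreasing_is_cvgn (dec x) _; exists 0 => _ [n _ <-].
  exact: iter_step_ge0.
pose f x := limn (fun n => iter n step g x).
have cvf x : (iter n step g x @[n --> \oo] --> f x)%classic by exact: cv.
exists f; split=> // x.
  rewrite limr_ge//=; last by apply: nearW => n; exact: iter_step_ge0.
  exact: (nonincreasing_cvgn_ge (dec x) (@cv x) 0%N).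
have lim_step := cvg_step (x := x) cvf.
have := cvf x; rewrite -(cvg_shiftS (fun n => iter n step g x)) => lim_shift.
exact: (cvg_unique _ lim_step lim_shift).
Qed.

Lemma iter_stepD a b u f n x :
  iter n step (fun y => a * u y + b * f y) x =
  a * iter n step u x + b * iter n step f x.
Proof.
elim: n x => [//|n IH] x.
by rewrite !iterS -stepD; congr (step _ x); apply/funext => y; exact: IH.
Qed.

Lemma iter_step_harmonic u n x : (forall y, step u y = u y) ->
  iter n step u x = u x.
Proof. by move=> uh; elim: n x => [//|n IH] x /=; rewrite (funext IH). Qed.

Lemma extremal_barrier h g : extremal_potential N o h ->
  (forall x, 0 <= g x) -> (forall x, step g x <= g x) ->
  (exists x, g x < h x) ->
  exists w, [/\ forall x, 0 <= w x, forall x, step w x <= w x,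
    forall x, h x <= g x -> h x <= w x &
    (flow (iter n step w) @[n --> \oo] --> (0 : R))%classic].
Proof.
move=> eh g0 gs [x0 gx0].
have /potentialP[h0 ho hf hh] := eh.1.
pose m x := Num.min (h x) (g x).
have m0 x : 0 <= m x by rewrite /m le_min h0 g0.
have ms x : step m x <= m x.
  rewrite /m le_min; apply/andP; split.
    by rewrite -[leRHS]hh; apply: ler_step => y; rewrite ge_min lexx.
  by apply: le_trans (gs x); apply: ler_step => y; rewrite ge_min lexx orbT.
have [f [fm fh cvf]] := superharmonic_minorant m0 ms.
have fc : forall x, f x = flow f * h x.
  apply: extremal_minorant => // x; have /andP[-> fx] := fm x.
  by rewrite (le_trans fx)// ge_min lexx.
set c := flow f in fc *.
(* At [x0] the minimum is strictly below [h], so [c * h x0 = f x0 <= m x0 < h x0]. *)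
have c1 : c < 1.
  have hx0 : 0 < h x0 by exact: le_lt_trans gx0.
  have /andP[_ fx0] := fm x0.
  have : c * h x0 < h x0.
    by rewrite -fc (le_lt_trans fx0)// gt_min gx0 orbT.
  by rewrite gtr_pMl.
have cne : 1 - c != 0 by rewrite subr_eq0 gt_eqF.
have ci0 : 0 <= (1 - c)^-1 by rewrite invr_ge0 subr_ge0 ltW.
pose w x := (1 - c)^-1 * m x + (- (1 - c)^-1) * f x.
have wE x : w x = (1 - c)^-1 * (m x - f x) by rewrite /w; ring.
exists w; split.
- by move=> x; rewrite wE mulr_ge0// subr_ge0; case/andP: (fm x).
- by move=> x; rewrite /w stepD fh lerD2r ler_wpM2l.
(* Here [m x = h x], so [w x = (h x - c * h x) / (1 - c) = h x]; this dictates the scaling of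
   [w]. *)
- move=> x hg; rewrite wE fc /m; move/min_idPl: hg => ->.
  by rewrite le_eqVlt; apply/orP; left; apply/eqP; field.
(* The iterates of [m] tend to [f], whose flow is [c], while [f] itself stays fixed: the two terms
   cancel in the limit. *)
- have E n : flow (iter n step w) =
      (1 - c)^-1 * flow (iter n step m) + (- (1 - c)^-1) * c.
    rewrite -flowD; congr flow; apply/funext => x.
    by rewrite /w iter_stepD (iter_step_harmonic n x fh).
  under eq_fun do rewrite E.
  have -> : 0 = (1 - c)^-1 * c + (- (1 - c)^-1) * c by ring.
  apply: cvgD; last exact: cvg_cst.
  by apply: cvgM; [exact: cvg_cst|exact: cvg_flow].
Qed.

End PotentialTheory.

(** * Real-valued probabilities and splitting an event along the values of a variable *)

Section FiniteProbability.
Variables (R : realType) (d : measure_display) (T : measurableType d).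
Variable P : probability T R.
Implicit Types A B C E : set T.

Definition pr A : R := fine (P A).

Lemma prE A : measurable A -> P A = (pr A)%:E.
Proof. by move=> mA; rewrite fineK// fin_num_measure. Qed.

Lemma pr_ge0 A : 0 <= pr A.
Proof. exact/fine_ge0/measure_ge0. Qed.

Lemma pr0 : pr set0 = 0.
Proof. by rewrite /pr measure0. Qed.

Lemma le_pr A B : measurable A -> measurable B -> A `<=` B -> pr A <= pr B.
Proof. by move=> mA mB AB; rewrite -lee_fin -!prE// le_measure// inE. Qed.

Lemma prU A B : measurable A -> measurable B -> A `&` B = set0 ->
  pr (A `|` B) = pr A + pr B.
Proof.
move=> mA mB AB; apply: EFin_inj; rewrite EFinD -!prE//; first exact: measureU.
exact: measurableU.
Qed.

Lemma pr_fibers (V : choiceType) (X : T -> V) (s : seq V) C :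
  (forall D : set V, measurable (X @^-1` D)) -> uniq s -> measurable C ->
  pr (C `&` X @^-1` [set` s]) = \sum_(y <- s) pr (C `&` X @^-1` [set y]).
Proof.
move=> mX + mC; elim: s => [_|y s IH /= /andP[ys us]].
  rewrite big_nil -pr0; congr pr; rewrite -subset0 => w [_ /=].
  by rewrite in_nil.
rewrite big_cons -IH// -prU.
- by congr pr; rewrite -setIUr -preimage_setU; congr (_ `&` X @^-1` _);
    apply/seteqP; split=> z /=; rewrite in_cons => /predU1P.
- exact: measurableI.
- exact: measurableI.
- by rewrite -subset0 => w [[_ /= ->] [_ /=]]; rewrite (negPf ys).
Qed.

(** The last premise says that the fibers over [s] carry the whole mass of [C], so what remains of
    [C] is null and cannot contribute to [E]. *)
Lemma pr_le_fibers (V : choiceType) (X : T -> V) (s : seq V) C E :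
  (forall D : set V, measurable (X @^-1` D)) -> uniq s ->
  measurable C -> measurable E ->
  pr C = \sum_(y <- s) pr (C `&` X @^-1` [set y]) ->
  pr (C `&` E) <= \sum_(y <- s) pr (C `&` X @^-1` [set y] `&` E).
Proof.
move=> mX us mC mE; rewrite -pr_fibers//; set B := X @^-1` _ => CB.
have mB : measurable B by exact: mX.
have mCB : measurable (C `&` B) by exact: measurableI.
have mCE : measurable (C `&` E) by exact: measurableI.
have mCD : measurable (C `\` B) by exact: measurableD.
have CD0 : pr (C `\` B) = 0.
  apply: (@addrI _ (pr (C `&` B))); rewrite addr0 -prU//.
    by rewrite setUIDK.
  by rewrite setIDA setDE; apply/seteqP; split => // w [[[? ?] ?]].
under eq_bigr do rewrite setIAC.
rewrite -pr_fibers// -/B -[leRHS]addr0 -CD0 -prU//; first last.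
- by rewrite -subset0 => w [[_ Bw] [_]].
- exact: measurableI.
apply: le_pr => //; first by apply: measurableU => //; exact: measurableI.
by move=> w [Cw Ew]; have [Bw|Bw] := pselect (B w); [left|right].
Qed.

End FiniteProbability.

(** * Hitting estimates for the [h]-process *)

Section HProcess.
Variables (R : realType) (V : choiceType) (N : network R V) (o : V).
Variables (d : measure_display) (T : measurableType d) (P : probability T R).
Variables (h : V -> R) (Y : nat -> T -> V).
Hypotheses (ph : potential N o h) (hY : h_process N P o h Y).
Implicit Types (u : V -> R) (x : nat -> V) (n k : nat) (A : set V).

Let mY n A : measurable (Y n @^-1` A).
Proof. by have [+ _ _ _] := hY; apply. Qed.

Let h_gt0 n w : 0 < h (Y n w). Proof. by have [_ + _ _] := hY; apply. Qed.

Definition cyl n x : set T := [set w | forall i, (i <= n)%N -> Y i w = x i].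

Lemma cylS n x :
  cyl n.+1 x = cyl n x `&` Y n.+1 @^-1` [set x n.+1].
Proof.
apply/seteqP; split=> w /=.
  by move=> H; split=> [i /leqW|]; exact: H.
by move=> [H E] i; rewrite leq_eqVlt => /predU1P[->//|]; exact: H.
Qed.

Lemma cyl0 x : cyl 0 x = Y 0%N @^-1` [set x 0%N].
Proof.
by apply/seteqP; split=> w /= => [H|E i]; [exact: H|rewrite leqn0 => /eqP ->].
Qed.

Lemma measurable_cyl n x : measurable (cyl n x).
Proof.
elim: n => [|n IH]; first by rewrite cyl0; exact: mY.
by rewrite cylS; apply: measurableI.
Qed.

(** The Markov clause wants a sequence staying in the state space at all times, so every coordinate
    after [n] is set to [y]; the cylinder does not see them. *)
Lemma cyl_extend n x y : (forall i, 0 < h (x i)) -> 0 < h y ->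
  exists x', [/\ forall i, 0 < h (x' i), x' n = x n, x' n.+1 = y &
    cyl n x' = cyl n x].
Proof.
move=> hx hy; exists (fun i => if (i <= n)%N then x i else y); split.
- by move=> i; case: ifP.
- by rewrite leqnn.
- by rewrite ltnn.
- by apply/seteqP; split=> w H i ni; have := H _ ni; rewrite ni.
Qed.

Lemma fiber_eq0 n y : ~~ (0 < h y) -> Y n @^-1` [set y] = set0.
Proof.
by move=> hy; rewrite -subset0 => w /= E; move: hy; rewrite -E h_gt0.
Qed.

Lemma pr_cylS n x y : (forall i, 0 < h (x i)) ->
  pr P (cyl n x `&` Y n.+1 @^-1` [set y]) =
  pr P (cyl n x) * (trans_prob N (x n) y * h y / h (x n)).
Proof.
move=> hx; have [hy|hy] := boolP (0 < h y); last first.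
  rewrite fiber_eq0// setI0 pr0; have [h0 _ _ _] := ph.
  suff -> : h y = 0 by rewrite mulr0 mul0r mulr0.
  by apply/eqP; rewrite eq_le h0 andbT leNgt.
have [x' [hx' x'n x'Sn Ex]] := cyl_extend n hx hy.
have [_ _ _ /(_ n x' hx')] := hY.
rewrite -/(cyl n.+1 x') -/(cyl n x') cylS Ex x'n x'Sn /pr => ->.
by rewrite fineM// fin_num_measure//; exact: measurable_cyl.
Qed.

(** Split on the next vertex: the factor [h y] of the transition probability cancels the denominator
    of [u y / h y], and summing over neighbours leaves [step u / h]. Bounds thus propagate backwards
    in time. *)
Lemma cyl_le_step n x u (E : set T) : measurable E ->
  (forall i, 0 < h (x i)) -> (forall y, 0 <= u y) ->
  (forall x', (forall i, 0 < h (x' i)) ->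
    pr P (cyl n.+1 x' `&` E) <=
    pr P (cyl n.+1 x') * (u (x' n.+1) / h (x' n.+1))) ->
  pr P (cyl n x `&` E) <= pr P (cyl n x) * (step N o u (x n) / h (x n)).
Proof.
move=> mE hx u0 H; have /potentialP[h0 ho _ hh] := ph.
have xo : (x n == o) = false.
  by apply/negP => /eqP xo; have := hx n; rewrite xo ho ltxx.
have hxn : h (x n) != 0 by rewrite gt_eqF.
apply: le_trans (pr_le_fibers (s := nbs N (x n)) (mY n.+1) _ _ mE _) _.
- exact: nbs_uniq.
- exact: measurable_cyl.
(* Harmonicity of [h] makes the transition probabilities from [x n] sum to one, so the neighbours
   exhaust the cylinder. *)
- under eq_bigr do rewrite pr_cylS//.
  rewrite -mulr_sumr -mulr_suml.
  have := hh (x n); rewrite /step xo => ->.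
  by rewrite mulfV// mulr1.
rewrite /step xo mulr_suml mulr_sumr; apply: ler_sum => y _.
have [hy|hy] := boolP (0 < h y); last first.
  rewrite fiber_eq0// setI0 set0I pr0 mulr_ge0 ?pr_ge0//.
  by rewrite divr_ge0// mulr_ge0// trans_prob_ge0.
have [x' [hx' x'n x'Sn Ex]] := cyl_extend n hx hy.
have := H x' hx'; rewrite cylS Ex x'Sn => /le_trans; apply.
rewrite pr_cylS// le_eqVlt; apply/orP; left; apply/eqP; field.
by apply/andP; split => //; rewrite gt_eqF.
Qed.

(** The same cancellation at time 0; [flow h = 1] says that the neighbours of [o] carry all the
    initial mass. *)
Lemma pr_le_flow u (E : set T) : measurable E -> (forall y, 0 <= u y) ->
  (forall x, (forall i, 0 < h (x i)) ->
    pr P (cyl 0 x `&` E) <= pr P (cyl 0 x) * (u (x 0%N) / h (x 0%N))) ->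
  pr P E <= flow N o u.
Proof.
move=> mE u0 H; have /potentialP[h0 ho hf hh] := ph.
have prY0 y : adj N o y -> pr P (Y 0%N @^-1` [set y]) = cond N o y * h y.
  move=> oy; have [hy|hy] := boolP (0 < h y); last first.
    rewrite fiber_eq0// pr0; suff -> : h y = 0 by rewrite mulr0.
    by apply/eqP; rewrite eq_le h0 andbT leNgt.
  by have [_ _ /(_ y hy) + _] := hY; rewrite oy /pr => ->.
rewrite -[E]setTI.
apply: le_trans (pr_le_fibers (s := nbs N o) (mY 0%N) _ measurableT mE _) _.
- exact: nbs_uniq.
- rewrite [LHS]/pr probability_setT /= -hf; apply: eq_big_seq => y.
  by rewrite mem_nbs setTI => /prY0 ->.
rewrite /flow big_seq [leRHS]big_seq; apply: ler_sum => y.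
rewrite mem_nbs setTI => oy.
have [hy|hy] := boolP (0 < h y); last first.
  by rewrite fiber_eq0// set0I pr0 mulr_ge0// ltW// cond_gt0.
have := H (fun=> y) (fun=> hy); rewrite cyl0 prY0// => /le_trans; apply.
by rewrite le_eqVlt; apply/orP; left; apply/eqP; field; rewrite gt_eqF.
Qed.

(** The bounded window allows induction on [k]; unbounded hitting is recovered as an increasing
    union in [eventually_avoids]. *)
Definition hits A n k : set T :=
  [set w | exists2 j, (j <= k)%N & A (Y (n + j) w)].

Lemma measurable_hits A n k : measurable (hits A n k).
Proof.
have -> : hits A n k = \bigcup_(j in `I_k.+1) Y (n + j) @^-1` A.
  by apply/seteqP; split=> w [j jk Aj]; exists j.
by apply: bigcup_measurable => j _; exact: mY.
Qed.

Section Barrier.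
Variables (A : set V) (u : V -> R).
Hypotheses (u0 : forall y, 0 <= u y) (us : forall y, step N o u y <= u y).
Hypothesis hu : forall y, A y -> h y <= u y.

(** Maximal inequality for the nonnegative supermartingale [u / h], which is at least 1 on [A].
    Inside [A] the bound is trivial; outside, the window loses its first time and superharmonicity
    absorbs one step. *)
Lemma pr_cyl_hits n k x : (forall i, 0 < h (x i)) ->
  pr P (cyl n x `&` hits A n k) <= pr P (cyl n x) * (u (x n) / h (x n)).
Proof.
have near n' k' x' : (forall i, 0 < h (x' i)) -> A (x' n') ->
  pr P (cyl n' x' `&` hits A n' k') <=
  pr P (cyl n' x') * (u (x' n') / h (x' n')).
  move=> hx' Ax'; have mC := measurable_cyl n' x'.
  apply: (@le_trans _ _ (pr P (cyl n' x'))).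
    apply: le_pr => //.
    by apply: (measurableI _ _ mC); exact: measurable_hits.
  by apply: ler_peMr; rewrite ?pr_ge0// ler_pdivlMr// mul1r hu.
elim: k n x => [|k IH] n x hx.
  have [Ax|Ax] := pselect (A (x n)); first exact: near.
  rewrite (_ : _ `&` _ = set0) ?pr0.
    by rewrite mulr_ge0 ?pr_ge0// divr_ge0// ltW.
  rewrite -subset0 => w [Cw [j]]; rewrite leqn0 => /eqP ->.
  by rewrite addn0 Cw.
have [Ax|Ax] := pselect (A (x n)); first exact: near.
have mC := measurable_cyl n x.
have mH := measurable_hits A n.+1 k.
apply: (@le_trans _ _ (pr P (cyl n x `&` hits A n.+1 k))).
  apply: le_pr; [|exact: measurableI _ _ mC mH|].
    by apply: (measurableI _ _ mC); exact: measurable_hits.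
  move=> w [Cw [[|j] jk]]; first by rewrite addn0 Cw.
  by rewrite addnS => AY; split=> //; exists j.
apply: le_trans (cyl_le_step (u := u) mH hx u0 _) _; first exact: IH.
by rewrite ler_wpM2l ?pr_ge0// ler_pM2r// invr_gt0.
Qed.

(** Each step of waiting before the window opens costs one application of [cyl_le_step], hence one
    more iterate of [u]. *)
Lemma pr_cyl_late_hits n m k x : (forall i, 0 < h (x i)) ->
  pr P (cyl n x `&` hits A (n + m) k) <=
  pr P (cyl n x) * (iter m (step N o) u (x n) / h (x n)).
Proof.
elim: m n x => [|m IH] n x hx; first by rewrite addn0; exact: pr_cyl_hits.
apply: cyl_le_step => //; first exact: measurable_hits.
  by move=> y; exact: iter_step_ge0.
by move=> x' hx'; rewrite -addSnnS; exact: IH.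
Qed.

Lemma pr_hits m k : pr P (hits A m k) <= flow N o (iter m (step N o) u).
Proof.
apply: pr_le_flow; first exact: measurable_hits.
  by move=> y; exact: iter_step_ge0.
by move=> x hx; have := @pr_cyl_late_hits 0 m k x hx; rewrite add0n.
Qed.

Lemma eventually_avoids :
  (flow N o (iter m (step N o) u) @[m --> \oo] --> (0 : R))%classic ->
  {ae P, forall w, exists n0, forall n, (n0 <= n)%N -> ~ A (Y n w)}.
Proof.
move=> flow0.
pose H m := \bigcup_k hits A m k.
have mH m : measurable (H m).
  by apply: bigcupT_measurable => k; exact: measurable_hits.
(* The bound of [pr_hits] is uniform in [k], so it survives continuity from below. *)
have PH m : pr P (H m) <= flow N o (iter m (step N o) u).
  have cv : (P \o hits A m) k @[k --> \oo] --> P (H m).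
    apply: nondecreasing_cvg_mu; [|exact: mH|].
      by move=> k; exact: measurable_hits.
    move=> k l kl; apply/subsetPset => w [j jk Aj].
    by exists j => //; exact: leq_trans kl.
  rewrite -lee_fin -prE// -(cvg_lim _ cv)//.
  apply: lime_le; first by apply/cvg_ex; exists (P (H m)).
  apply: nearW => k /=; rewrite prE ?lee_fin; first exact: pr_hits.
  exact: measurable_hits.
(* The exceptional event: [A] is hit at or after every time [m]. *)
exists (\bigcap_m H m); split.
- exact: bigcapT_measurable.
- rewrite prE; last exact: bigcapT_measurable.
  congr EFin; apply/eqP; rewrite eq_le pr_ge0 andbT.
  rewrite -(cvg_lim _ flow0)//; apply: limr_ge; first by apply/cvg_ex; exists 0.
  apply: nearW => m; apply: le_trans (PH m).
  by apply: le_pr => //; [exact: bigcapT_measurable|exact: bigcap_inf].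
- move=> w /= Hw m _; apply: contrapT => nH; apply: Hw; exists m => n mn AY.
  by apply: nH; exists (n - m)%N => //; exists (n - m)%N => //; rewrite subnKC.
Qed.

End Barrier.

End HProcess.

(** * Long-term behaviour of the process of an extremal potential *)

Section ExtremalProcess.
Variables (R : realType) (V : choiceType) (N : network R V) (o : V).
Variables (d : measure_display) (T : measurableType d) (P : probability T R).
Variables (h : V -> R) (Y : nat -> T -> V).
Hypotheses (eh : extremal_potential N o h) (hY : h_process N P o h Y).

Lemma extremal_process_escapes (g : V -> R) :
  (forall x, 0 <= g x) -> (forall x, step N o g x <= g x) ->
  (exists x, g x < h x) ->
  {ae P, forall w, exists n0, forall n, (n0 <= n)%N -> g (Y n w) < h (Y n w)}.
Proof.
move=> g0 gs gh; have [u [u0 us hu cvu]] := extremal_barrier eh g0 gs gh.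
have := eventually_avoids (A := [set x | h x <= g x]) eh.1 hY u0 us hu cvu.
apply: filterS => w [n0 H]; exists n0 => n /H /= /negP.
by rewrite -ltNge.
Qed.

Lemma extremal_process_transient :
  {ae P, forall w, forall v, finite_set [set n | Y n w = v]}.
Proof.
(* A countable family of levels, so that one null set serves them all; codes of no rational default
   to the level 0. *)
pose q n : R := ratr (odflt 0 (choice.unpickle n : option rat)).
have : {ae P, forall w, forall k, 0 <= q k -> (exists x, q k < h x) ->
    exists n0, forall n, (n0 <= n)%N -> q k < h (Y n w)}.
  apply: ae_foralln => k.
  have [q0|] := boolP (0 <= q k); last by move=> ?; exact: aeW.
  have [qh|?] := pselect (exists x, q k < h x); last exact: aeW.
  have := @extremal_process_escapes (fun=> q k) (fun=> q0)
    (fun x => step_cst_le N o x q0) qh.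
  by apply: filterS => w H _ _.
apply: filterS => w H v; have [_ /(_ _ w) hgt0 _ _] := hY.
have [hv|hv] := boolP (0 < h v); last first.
  rewrite (_ : [set n | _] = set0); first exact: finite_set0.
  by rewrite -subset0 => n /= Yn; move: hv; rewrite -Yn hgt0.
(* Choose a rational level between [h v] and a larger value of [h]: the path eventually stays above
   it and so leaves [v] for good. *)
have [y vy] := potential_not_max eh.1 hv.
have [r] := rat_in_itvoo vy; rewrite in_itv/= => /andP[vr ry].
have qr : q (choice.pickle r) = ratr r by rewrite /q choice.pickleK.
have [] := H (choice.pickle r); rewrite qr.
- exact: ltW (lt_trans hv vr).
- by exists y.
move=> n0 Hn0; apply: (sub_finite_set _ (finite_II n0)) => n /= Yn.
rewrite ltnNge; apply/negP => /Hn0; rewrite Yn.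
by move=> /(lt_trans vr); rewrite ltxx.
Qed.

Lemma extremal_process_dominates (f : V -> R) : potential N o f -> h <> f ->
  {ae P, forall w, exists n0, forall n, (n0 <= n)%N -> f (Y n w) < h (Y n w)}.
Proof.
move=> pf hf; have /potentialP[f0 _ _ fh] := pf.
apply: extremal_process_escapes => //; first by move=> x; rewrite fh.
(* Without a vertex where [f < h], [h] would lie below [f] and equal it. *)
apply: contrapT => /forallNP nlt; apply/hf/(potential_le_eq eh.1 pf) => x.
by rewrite leNgt; apply/negP; exact: nlt.
Qed.

End ExtremalProcess.

(** * From separated trajectories to finitely many meetings *)

Lemma finite_meetings (V : Type) (y z : nat -> V) (A : set V) (k l : nat) :
  (forall v, finite_set [set n | y n = v]) ->
  (forall v, finite_set [set n | z n = v]) ->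
  (forall n, (k <= n)%N -> A (y n)) -> (forall n, (l <= n)%N -> ~ A (z n)) ->
  finite_set [set mn : nat * nat | y mn.1 = z mn.2].
Proof.
move=> fy fz Ay nAz.
(* Meetings with [m < k] or [n < l]: each fixed index has finitely many partners. Beyond both bounds
   [A] separates [y m] from [z n]. *)
pose B := \bigcup_(m in `I_k) ([set m] `*` [set n | z n = y m]).
pose C := \bigcup_(n in `I_l) ([set m | y m = z n] `*` [set n]).
apply: (@sub_finite_set _ _ (B `|` C)); last first.
  rewrite finite_setU; split; apply: bigcup_finite => [|i _];
    try exact: finite_II.
  - by apply: finite_setX => //; exact: finite_set1.
  - by apply: finite_setX => //; exact: finite_set1.
move=> [m n] /= ymn; have [mk|km] := ltnP m k; first by left; exists m.
right; exists n => //=; rewrite ltnNge; apply/negP => /nAz; apply.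
by rewrite -ymn; exact: Ay.
Qed.

Theorem corollary5p2 (R : realType) (V : choiceType) (N : network R V) (o : V)
    (h1 h2 : V -> R) (d : measure_display) (T : measurableType d)
    (P : probability T R) (Y Z : nat -> T -> V) :
  recurrent N ->
  extremal_potential N o h1 ->
  extremal_potential N o h2 ->
  h1 <> h2 ->
  h_process N P o h1 Y ->
  h_process N P o h2 Z ->
  {ae P, forall w, finite_set [set mn : nat * nat | Y mn.1 w = Z mn.2 w]}.
Proof.
move=> _ eh1 eh2 h12 hY hZ; have h21 : h2 <> h1 by move/esym.
have Zdom := extremal_process_dominates eh2 hZ eh1.1 h21.
have Ydom := extremal_process_dominates eh1 hY eh2.1 h12.
have fin : {ae P, forall w, (forall v, finite_set [set n | Y n w = v]) /\
    (forall v, finite_set [set n | Z n w = v])}.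
  have := extremal_process_transient eh2 hZ.
  by apply: filterS2 (extremal_process_transient eh1 hY) => w.
apply: filterS3 fin Ydom Zdom => w [fY fZ] [k Yk] [l Zl].
(* [Y] ends up inside this set and [Z] outside it, since there [h1 < h2]. *)
apply: (@finite_meetings _ (Y ^~ w) (Z ^~ w) [set v | h2 v < h1 v] k l) => //.
by move=> n /Zl /ltW /=; rewrite leNgt => /negP.
Qed.
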